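(* If $X$ is a $T_{1}$ space, then $|X|\leq UW(X)\cdot\psi w_{\theta}(X)^{h\theta\text{-}aL(X)}$.
   Context: For $A\subseteq X$, the $\theta$-closure is $cl_{\theta}(A)=\{x\in X:\ \overline{U}\cap A\neq\emptyset \text{ for every open neighborhood } U \text{ of } x\}$. For a $T_1$ space $X$ and $x\in X$, $Uw(x)=\bigcap\{cl_{\theta}(\overline{U}):x\in U,\ U\text{ open}\}$, and the Urysohn width is $UW(X)=\sup\{|Uw(x)|:x\in X\}$ (this value may be finite). $\psi w_{\theta}(x)$ is the least cardinality of a family $\mathcal{U}_x$ of open neighborhoods of $x$ such that $\bigcap\{cl_{\theta}(\overline{U}):U\in\mathcal{U}_x\}=Uw(x)$, and $\psi w_{\theta}(X)=\sup\{\psi w_{\theta}(x):x\in X\}$. For $Y\subseteq X$, $\theta\text{-}aL(Y,X)$ is the least cardinal $\kappa$ such that every cover $\mathcal{V}$ of $Y$ by open subsets of $X$ has a subfamily $\mathcal{V}'\subseteq\mathcal{V}$ with $|\mathcal{V}'|\leq\kappa$ and $Y\subseteq\bigcup\{cl_{\theta}(\overline{V}):V\in\mathcal{V}'\}$, where closures and $\theta$-closures are taken in $X$. The hereditary version is $h\theta\text{-}aL(X)=\sup\{\theta\text{-}aL(Y,X):Y\subseteq X\}$. Convention: the cardinal functions $\psi w_{\theta}$ and $h\theta\text{-}aL$ are taken to be infinite-valued (i.e. $\aleph_0$ is added: $\psi w_{\theta}(X)$ stands for $\aleph_0+\sup\{\psi w_{\theta}(x):x\in X\}$, and $h\theta\text{-}aL(X)$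 stands for $\aleph_0+\sup\{\theta\text{-}aL(Y,X):Y\subseteq X\}$); $UW(X)$ is not modified. *)

(* Defs.v *)
From HB Require Import structures.
From mathcomp Require Import all_boot.
From mathcomp Require Import boolp classical_sets functions cardinality.
From mathcomp Require Import topology.

Set Implicit Arguments.
Unset Strict Implicit.
Unset Printing Implicit Defensive.

Local Open Scope classical_set_scope.
Local Open Scope card_scope.

(* A cardinal is represented by any type of that cardinality: sums, products
   and powers of cardinals are disjoint unions, cartesian products and function
   types, and K is at most L when [set: K] #<= [set: L]. *)

Definition is_least_card (P : Type -> Prop) (K : Type) : Prop :=
  P K /\ forall L : Type, P L -> [set: K] #<= [set: L].

(* Determined by P up to equipotence.  The default value void is only used when
   no type satisfies P, see least_cardP. *)
Definition least_card (P : Type -> Prop) : Type :=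
  if pselect (exists K, is_least_card P K) is left e
  then projT1 (cid e) else void.

Definition card_sup (I : Type) (F : I -> Type) : Type :=
  least_card (fun K => forall i, [set: F i] #<= [set: K]).

Section Theta.
Context {X : topologicalType}.

Definition theta_closure (A : set X) : set X :=
  [set x | forall U : set X, open U -> U x -> closure U `&` A !=set0].

Definition urysohn_core (x : X) : set X :=
  \bigcap_(U in [set U : set X | open U /\ U x]) theta_closure (closure U).

Definition psiw_theta_at (x : X) : Type :=
  least_card (fun K => exists B : set (set X),
    [/\ forall U, B U -> open U /\ U x,
        \bigcap_(U in B) theta_closure (closure U) = urysohn_core x
      & B #= [set: K]]).

Definition theta_aL (Y : set X) : Type :=
  least_card (fun K => forall V : set (set X),
    (forall U, V U -> open U) -> Y `<=` \bigcup_(U in V) U ->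
    exists V' : set (set X),
      [/\ V' `<=` V, V' #<= [set: K]
        & Y `<=` \bigcup_(U in V') theta_closure (closure U)]).

End Theta.

(* Not increased by aleph_0, unlike psiw_theta and htheta_aL. *)
Definition urysohn_width (X : topologicalType) : Type :=
  card_sup (fun x : X => set_type (urysohn_core x)).

Definition psiw_theta (X : topologicalType) : Type :=
  (nat + card_sup (fun x : X => psiw_theta_at x))%type.

Definition htheta_aL (X : topologicalType) : Type :=
  (nat + card_sup (fun Y : set X => theta_aL Y))%type.

Lemma card_leTP (T U : Type) :
  [set: T] #<= [set: U] <-> exists f : T -> U, injective f.
Proof.
split=> [/card_leP[f]|[f fI]].
  exists (fun t => val (f (to_setT t))) => x y /val_inj fxy.
  have /(congr1 val) // : to_setT x = to_setT y.
  by have := @inj _ _ _ f; apply => //; rewrite in_setT.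
apply/card_leP.
suff /injfunPex : exists2 g : [set: T] -> [set: U],
  set_fun setT setT g & set_inj setT g by [].
exists (fun t => to_setT (f (val t))) => // x y _ _ /(congr1 val) /= /fI.
exact: val_inj.
Qed.

(* Any nonempty family of types has a member that injects into all the others,
   by Zorn's lemma applied to the sets of choice functions that pairwise differ
   at every index. *)
Lemma exists_least (I : Type) (F : I -> Type) (i0 : I) :
  exists i, forall j, [set: F i] #<= [set: F j].
Proof.
pose P (S : set (forall i, F i)) :=
  forall f g, S f -> S g -> forall i, f i = g i -> f = g.
have [G GP Gtot|S [PS Smax]] := @Zorn_bigcup _ P.
  move=> f g [A GA Af] [B GB Bg].
  have [AB|BA] := Gtot _ _ GA GB; first exact: (GP _ GB) (AB _ Af) Bg.
  exact: (GP _ GA) Af (BA _ Bg).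
have [[i iP]|no] := pselect (exists i, forall a : F i, exists2 f, S f & f i = a).
  exists i => j; apply/card_leTP.
  have [h hP] := choice (fun a => let: ex_intro2 f Sf fa := iP a in
    ex_intro (fun f => S f /\ f i = a) f (conj Sf fa)).
  exists (fun a => h a j) => a b hab.
  have [[Sa <-] [Sb <-]] := (hP a, hP b).
  by rewrite (PS _ _ Sa Sb _ hab).
have new i : exists a : F i, forall f, S f -> f i <> a.
  apply: contrapT => noi; apply: no; exists i => a; apply: contrapT => nof.
  by apply: noi; exists a => f Sf fia; apply: nof; exists f.
pose g i := projT1 (cid (new i)).
have gP i f : S f -> f i <> g i by move=> Sf; exact: (projT2 (cid (new i))).
case: (Smax (S `|` [set g])).
  split; first by move=> f; left.
  by move=> /(_ g (or_intror erefl)) Sg; exact: (gP i0 g Sg).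
move=> f h [Sf|/= ->] [Sh|/= ->] i fh //; first exact: PS fh.
- by case: (gP i f Sf).
- by case: (gP i h Sh).
Qed.

Lemma least_cardP (P : Type -> Prop) :
  (exists K, P K) -> is_least_card P (least_card P).
Proof.
move=> [K0 PK0]; rewrite /least_card; case: pselect => [e|[]].
  exact: (projT2 (cid e)).
pose Q (A : set K0) := exists L, P L /\ [set: L] #= A.
have Q0 : Q setT by exists K0; split.
have [[A [K [PK KA]]] Amin] :=
  exists_least (fun A : {A | Q A} => set_type (proj1_sig A)) (exist Q _ Q0).
exists K; split=> // L PL.
have AT (B : set K0) : [set: B] #= B by exact: card_setT.
have [[] K0L] := @exists_least bool (fun b => if b then K0 else L) true.
  apply: card_le_trans (K0L false); apply: card_le_trans (card_leT A).
  by have := KA; rewrite card_eq_le => /andP[].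
have /card_leTP[f fI] := K0L true.
have fL : [set: L] #= range f.
  by rewrite card_eq_sym; apply: inj_card_eq => x y _ _; exact: fI.
have Qf : Q (range f) by exists L; split.
have := Amin (exist Q _ Qf); rewrite /= (card_le_eql (AT _)) (card_le_eqr (AT _)).
by rewrite (card_le_eql KA) (card_le_eqr fL).
Qed.

Lemma card_sup_is_least (I : Type) (F : I -> Type) :
  is_least_card (fun K => forall i, [set: F i] #<= [set: K]) (card_sup F).
Proof.
apply: least_cardP; exists {i & F i} => i; apply/card_leTP.
by exists (existT F i) => x y; exact: (@existT_inj2 {classic I} F).
Qed.

Section Exist.
Context {X : topologicalType}.

Lemma psiw_theta_at_is_least (x : X) :
  is_least_card (fun K => exists B : set (set X),
    [/\ forall U, B U -> open U /\ U x,
        \bigcap_(U in B) theta_closure (closure U) = urysohn_core x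
      & B #= [set: K]]) (psiw_theta_at x).
Proof.
apply: least_cardP; pose B := [set U : set X | open U /\ U x].
by exists B, B; split=> //; rewrite card_eq_sym; exact: card_setT.
Qed.

Lemma sub_theta_closure (U : set X) : U `<=` theta_closure (closure U).
Proof.
move=> x Ux V oV Vx; exists x.
by split; exact: subset_closure.
Qed.

Lemma theta_aL_is_least (Y : set X) :
  is_least_card (fun K => forall V : set (set X),
    (forall U, V U -> open U) -> Y `<=` \bigcup_(U in V) U ->
    exists V' : set (set X),
      [/\ V' `<=` V, V' #<= [set: K]
        & Y `<=` \bigcup_(U in V') theta_closure (closure U)]) (theta_aL Y).
Proof.
apply: least_cardP; exists (set X) => V _ YV; exists V; split=> //.
  exact: card_leT.
by move=> y /YV[U VU Uy]; exists U => //; exact: sub_theta_closure.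
Qed.

End Exist.

(* Main.v *)
Require Import Defs.
From mathcomp Require Import all_boot.
From mathcomp Require Import boolp classical_sets functions cardinality.
From mathcomp Require Import topology.

(** Write K for the hereditary theta-aL number, L for psiw_theta, and fix at each
    point x neighborhoods U_l(x), indexed by L, such that any point lying in
    every C_l(x) := theta_closure (closure U_l(x)) lies in the Urysohn core of x.
    The idea is to find a set H of at most L^K points whose cores cover X; since
    each core has at most UW points, this bounds the cardinality of X by UW * L^K.

    H is obtained by closing off: start from a point, and whenever K many sets
    C_l(x) with x in H fail to cover X, put in H a point outside their union.
    Were some q in no core of a point of H, every x in H would have an index l(x)
    such that q is not in C_l(x)(x).  The open sets U_l(x)(x) cover H, hence by
    definition of K, applied to the subspace H, already K of the sets C_l(x)(x)
    cover H; they miss q, so H contains a point outside their union, a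
    contradiction (tree_core).

    Instead of iterating along the ordinals below K^+, the points of H are read
    off well-founded trees with K-indexed branching and edges labelled by L.
    Such a tree is determined by its labels along the finite paths, so that there
    are at most L^(seq K) = L^K trees (tree_inj).  This uses K * K <= K for
    infinite K (infinite_pairing), which is proved here from Zorn's lemma. *)

Set Implicit Arguments.
Unset Strict Implicit.
Unset Printing Implicit Defensive.

Local Open Scope classical_set_scope.
Local Open Scope card_scope.

(** * Injections *)

Lemma injection_total (T U : Type) :
  (exists f : T -> U, injective f) \/ (exists f : U -> T, injective f).
Proof.
have [[] le] := @exists_least bool (fun b => if b then T else U) true.
  by left; apply/card_leTP; exact: le false.
by right; apply/card_leTP; exact: le true.
Qed.

Lemma injective_cancel (T U : Type) (t0 : T) (f : T -> U) :
  injective f -> exists g : U -> T, cancel f g.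
Proof.
move=> fI.
exists (fun u => if pselect (exists t, f t = u) is left e
                 then projT1 (cid e) else t0) => t.
case: pselect => [e|[]]; last by exists t.
by apply: fI; exact: projT2 (cid e).
Qed.

Lemma sig_injection_total (T : Type) (t0 : T) (A B : set T)
    (g : {x | A x} -> {x | B x}) : injective g ->
  exists h : T -> T, (forall x, A x -> B (h x)) /\
    forall x y, A x -> A y -> h x = h y -> x = y.
Proof.
move=> gI.
exists (fun x => if pselect (A x) is left Ax
                 then proj1_sig (g (exist _ x Ax)) else t0); split=> [x Ax|].
  by case: pselect => // Ax'; exact: (proj2_sig (g _)).
move=> x y Ax Ay; do 2 case: pselect => // ?.
by move=> /(@eq_sig_hprop _ B (fun _ => @Prop_irrelevance _))/gI[].
Qed.

Lemma card_le_set_inj (T U : Type) (A : set T) (a : T) : A a -> A #<= [set: U] ->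
  exists f : T -> U, forall x y, A x -> A y -> f x = f y -> x = y.
Proof.
move=> Aa AU; have /card_leTP[f fI] : [set: A] #<= [set: U].
  by rewrite (card_le_eql (card_setT A)).
exists (fun x => if pselect (A x) is left Ax then f (SigSub (mem_set Ax))
                 else f (SigSub (mem_set Aa))) => x y Ax Ay.
do 2 case: pselect => // ?.
by move=> /fI/(congr1 val).
Qed.

(** * The square of an infinite cardinal *)

Definition pairing (T : Type) (A B : set T) (f : T -> T -> T) : Prop :=
  (forall x y, A x -> A y -> B (f x y)) /\
  (forall x y x' y', A x -> A y -> A x' -> A y' ->
     f x y = f x' y' -> x = x' /\ y = y').

Lemma pairing_nat (T : Type) (n : nat -> T) :
  injective n -> exists f : T -> T -> T, pairing (range n) (range n) f.
Proof.
move=> nI; have [i iK] := injective_cancel 0 nI.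
exists (fun x y => n (pickle (i x, i y))); split=> [x y _ _|]; first by eexists.
move=> _ _ _ _ [a _ <-] [b _ <-] [c _ <-] [d _ <-]; rewrite !iK.
by move=> /nI/(pcan_inj pickleK)[-> ->].
Qed.

(** An element x of B is recovered from the two elements u x and tag x of A, so
    that a pair in B amounts to four elements of A, and these can be merged by
    using f three times.  With a tag taking two values, B may be twice as large
    as A. *)
Lemma pairing_tagged (T : Type) (A B : set T) (f : T -> T -> T)
    (u tag : T -> T) :
  pairing A A f -> (forall x, B x -> A (u x)) -> (forall x, B x -> A (tag x)) ->
  (forall x y, B x -> B y -> u x = u y -> tag x = tag y -> x = y) ->
  exists h, pairing B A h.
Proof.
move=> [fA fI] uA tA utI.
exists (fun x y => f (f (u x) (u y)) (f (tag x) (tag y))); split.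
  by move=> x y Bx By; do 2 apply: (fA); auto.
move=> x y x' y' Bx By Bx' By' /fI[]; try by apply: (fA); auto.
by move=> /fI[]; auto=> eu ev /fI[]; auto.
Qed.

(** Chains of pairings have upper bounds, as Zorn's lemma requires: two elements
    of the union already lie in a common member of the chain. *)
Lemma pairing_chain (T I : Type) (F : set I) (A : I -> set T)
    (f : I -> T -> T -> T) :
  (forall i, F i -> pairing (A i) (A i) (f i)) ->
  (forall i j, F i -> F j ->
     (A i `<=` A j /\ forall x y, A i x -> A i y -> f i x y = f j x y) \/
     (A j `<=` A i /\ forall x y, A j x -> A j y -> f j x y = f i x y)) ->
  exists g, pairing (\bigcup_(i in F) A i) (\bigcup_(i in F) A i) g /\
    forall i x y, F i -> A i x -> A i y -> g x y = f i x y.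
Proof.
move=> Pf ch.
pose g x y := if pselect (exists i, [/\ F i, A i x & A i y]) is left e
  then f (projT1 (cid e)) x y else x.
have gE i x y : F i -> A i x -> A i y -> g x y = f i x y.
  move=> Fi xi yi; rewrite /g; case: pselect => [e|[]]; last by exists i.
  case: (cid e) => j [Fj xj yj] /=.
  by have [[_ ->]|[_ ->]] := ch _ _ Fi Fj.
have two i j : F i -> F j -> exists k, [/\ F k, A i `<=` A k & A j `<=` A k].
  move=> Fi Fj; have [[ij _]|[ji _]] := ch _ _ Fi Fj.
    by exists j; split.
  by exists i; split.
exists g; split=> //; split=> [x y [i Fi xi] [j Fj yj]|].
  have [k [Fk ik jk]] := two _ _ Fi Fj; exists k => //.
  by rewrite (gE k) //; [apply: (Pf k Fk).1; [exact: ik|exact: jk]|exact: ik|exact: jk].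
move=> x y x' y' [i Fi xi] [j Fj yj] [i' Fi' xi'] [j' Fj' yj'].
have [k [Fk ik jk]] := two _ _ Fi Fj.
have [k' [Fk' ik' jk']] := two _ _ Fi' Fj'.
have [m [Fm km km']] := two _ _ Fk Fk'.
have [mx my] := (km _ (ik _ xi), km _ (jk _ yj)).
have [mx' my'] := (km' _ (ik' _ xi'), km' _ (jk' _ yj')).
by rewrite !(gE m) //; exact: (Pf m Fm).2.
Qed.

(** If A has room for a disjoint copy of itself then its pairing extends strictly:
    the new pairs are coded in A by pairing_tagged and moved to the copy by g,
    where they cannot meet the values of f. *)
Lemma pairing_double (T : Type) (A : set T) (f : T -> T -> T)
    (g : T -> T) (a0 a1 : T) :
  pairing A A f -> A a0 -> A a1 -> a0 <> a1 ->
  (forall x y, A x -> A y -> g x = g y -> x = y) ->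
  (forall x, A x -> ~ A (g x)) ->
  exists f', pairing (A `|` g @` A) (A `|` g @` A) f' /\
    forall x y, A x -> A y -> f' x y = f x y.
Proof.
move=> fP A0 A1 a01 gI gA; have [fA fI] := fP.
have /choice[u uP] : forall x, exists a, (A `|` g @` A) x ->
    A a /\ x = if pselect (A x) then a else g a.
  move=> x.
  have [A'x|nA'] := pselect ((A `|` g @` A) x); last by exists x => /nA'.
  case: pselect => [Ax|nAx]; first by exists x.
  by case: A'x => [/nAx//|[a Aa gax]]; exists a.
have [||x y Bx By|h [hA hI]] := @pairing_tagged _ _ (A `|` g @` A) _ u
    (fun x => if pselect (A x) then a0 else a1) fP.
- by move=> x /uP[].
- by move=> x _; case: pselect.
- move: Bx By => /uP[_ +] /uP[_ +] /= e; rewrite e.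
  by do 2 case: pselect => ? /=; congruence.
exists (fun x y => if pselect (A x /\ A y) then f x y else g (h x y)).
split; last by move=> x y Ax Ay; case: pselect => // -[].
split=> [x y Ax Ay|x y x' y' Ax Ay Ax' Ay'].
  case: pselect => [[? ?]|?] /=; first by left; exact: fA.
  by right; exists (h x y) => //; exact: hA.
case: pselect => [[? ?]|?] /=; case: pselect => [[? ?]|?] /=.
- exact: fI.
- by move=> e; case: (gA (h x' y')); [exact: hA|rewrite -e; exact: fA].
- by move=> e; case: (gA (h x y)); [exact: hA|rewrite e; exact: fA].
- by move=> /gI e; apply: hI => //; apply: e; exact: hA.
Qed.

(** Only pairings that extend the one of the naturals are considered, so that the
    maximal one has at least two points to serve as tags. *)
Lemma maximal_pairing (T : Type) (n : nat -> T) : injective n ->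
  exists A (f : T -> T -> T), [/\ pairing A A f, range n `<=` A &
    forall B g, pairing B B g -> A `<=` B ->
      (forall x y, A x -> A y -> g x y = f x y) -> B `<=` A].
Proof.
move=> nI; have [f0 f0P] := pairing_nat nI.
pose S := {p : set T * (T -> T -> T) |
  pairing p.1 p.1 p.2 /\ range n `<=` p.1}.
pose le (p q : set T * (T -> T -> T)) := p.1 `<=` q.1 /\
  forall x y, p.1 x -> p.1 y -> p.2 x y = q.2 x y.
pose R (p q : S) := `[< le (proj1_sig p) (proj1_sig q) >].
pose s0 : S := exist _ (range n, f0) (conj f0P (@subset_refl _ (range n))).
have [| | |[[A f] /= [Af nA]] max] := @ZL_preorder _ s0 R.
- by move=> p; apply/asboolP; split.
- move=> q p r /asboolP[qp qpE] /asboolP[pr prE]; apply/asboolP; split.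
    exact: subset_trans pr.
  by move=> x y qx qy; rewrite qpE // prE //; exact: qp.
- move=> F Ftot; have [[s Fs]|F0] := pselect (F !=set0); last first.
    by exists s0 => s Fs; case: F0; exists s.
  have [||g [gP gE]] := @pairing_chain T S F (fun s => (proj1_sig s).1)
    (fun s => (proj1_sig s).2).
  + by move=> i _; exact: (proj2_sig i).1.
  + by move=> i j Fi Fj; have [/asboolP|/asboolP] := Ftot _ _ Fi Fj; [left|right].
  have nU : range n `<=` \bigcup_(s in F) (proj1_sig s).1.
    by move=> x nx; exists s => //; exact: (proj2_sig s).2.
  exists (exist _ (_, g) (conj gP nU)) => t Ft; apply/asboolP; split=> /=.
    by move=> x tx; exists t.
  by move=> x y tx ty; rewrite (gE t).
exists A, f; split=> // B g Bg AB gE.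
have nB := subset_trans nA AB.
pose s : S := exist _ (B, g) (conj Bg nB).
have /(max s) /asboolP[] // : R (exist _ (A, f) (conj Af nA)) s.
by apply/asboolP; split=> //= x y Ax Ay; rewrite gE.
Qed.

(** Let A carry a maximal pairing.  Its complement cannot receive an injection
    from A, by pairing_double, hence it injects into A.  Thus T is at most twice
    as large as A, and the pairing of A induces one of T. *)
Lemma infinite_pairing (T : Type) (n : nat -> T) : injective n ->
  exists f : T -> T -> T, pairing setT setT f.
Proof.
move=> nI; have [A [f [fP nA max]]] := maximal_pairing nI.
have A0 : A (n 0) by apply: nA; exists 0.
have A1 : A (n 1) by apply: nA; exists 1.
have n01 : n 0 <> n 1 by move=> /nI.
have [[g gI]|[g gI]] := injection_total {x | A x} {x | ~ A x}.
  have [h [hA hI]] := sig_injection_total (n 0) gI.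
  have [f' [f'P f'E]] := pairing_double fP A0 A1 n01 hI hA.
  case: (hA _ A0); apply: (max _ _ f'P _ f'E); first by move=> x; left.
  by right; exists (n 0).
have [h [hA hI]] := sig_injection_total (n 0) gI.
have [|||f' [_ f'I]] := @pairing_tagged _ _ setT _
    (fun x => if pselect (A x) then x else h x)
    (fun x => if pselect (A x) then n 0 else n 1) fP.
- by move=> x _; case: pselect => //= ?; exact: hA.
- by move=> x _; case: pselect.
- move=> x y _ _; do 2 case: pselect => ? //=; move=> e e01.
  + by case: n01.
  + exact: hI.
by exists f'.
Qed.

(** * Counting well-founded trees *)

Inductive tree (K L : Type) := Leaf | Node of (K -> tree K L) & (K -> L).
Arguments Leaf {K L}.

(** The labels of the edges leaving the node reached by the path s; the value None
    tells that s stops at a leaf or leaves the tree. *)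
Fixpoint labels (K L : Type) (t : tree K L) (s : seq K) (k : K) : option L :=
  if t is Node c a then
    if s is j :: s' then labels (c j) s' k else Some (a k)
  else None.

Lemma labels_inj (K L : Type) (k0 : K) : injective (@labels K L).
Proof.
elim=> [|c IHc a] [|d b] //= e.
- by have := congr1 (fun h => h [::] k0) e.
- by have := congr1 (fun h => h [::] k0) e.
have -> : c = d.
  apply: funext => j; apply: IHc; apply: funext => s.
  by have := congr1 (fun h => h (j :: s)) e.
have -> // : a = b.
by apply: funext => k; have := congr1 (fun h => h [::] k) e => -[].
Qed.

Lemma seq_inj (K : Type) (n : nat -> K) (p : K -> K -> K) :
  injective n -> pairing setT setT p -> exists e : seq K -> K, injective e.
Proof.
move=> nI [_ pI].
have {}pI x y x' y' : p x y = p x' y' -> x = x' /\ y = y' by exact: pI.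
exists (foldr (fun k c => p (n 1) (p k c)) (p (n 0) (n 0))).
by elim=> [|k s IHs] [|k' s'] //= /pI[] => [/nI|/nI|_ /pI[-> /IHs->]].
Qed.

Lemma tree_inj (K L : Type) (n : nat -> K) (o : option L -> L) :
  injective n -> injective o -> exists c : tree K L -> K -> L, injective c.
Proof.
move=> nI oI; have [p pP] := infinite_pairing nI.
have [e eI] := seq_inj nI pP.
have codeI : injective (fun sk : seq K * K => p (e sk.1) sk.2).
  by move=> [s k] [s' k'] /pP.2 /= []// /eI -> ->.
have [r rK] := injective_cancel ([::], n 0) codeI.
exists (fun t k => o (labels t (r k).1 (r k).2)) => t t' tt'.
apply: (labels_inj (n 0)); apply: funext => s; apply: funext => k; apply: oI.
by have := congr1 (fun h => h (p (e s) k)) tt'; rewrite (rK (s, k)).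
Qed.

(** * Closing off *)

(** The points p t form a set closed under escaping from small unions: the point
    of a node lies outside the union of the sets C x l that belong to the points of
    its children and to the labels of the edges towards them. *)
Lemma tree_core (X K L : Type) (x0 : X) (C : X -> L -> set X) :
  (forall (Y : set X) (a : X -> L), Y !=set0 -> exists s : K -> X,
     (forall k, Y (s k)) /\ Y `<=` \bigcup_k C (s k) (a (s k))) ->
  exists p : tree K L -> X, forall q, exists t, forall l, C (p t) l q.
Proof.
move=> small.
have /choice[out outP] : forall S : set X, exists x, S <> setT -> ~ S x.
  move=> S; have [[x nSx]|noS] := pselect (exists x, ~ S x); first by exists x.
  exists x0 => nS; case: nS; apply/seteqP; split=> x _ //.
  by apply: contrapT => nSx; apply: noS; exists x.
pose p := fix p (t : tree K L) :=
  if t is Node c a then out (\bigcup_k C (p (c k)) (a k)) else x0.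
exists p => q; apply: contrapT => noq.
have /choice[a aP] : forall x, exists l, range p x -> ~ C x l q.
  move=> x; have [[t _ <-]|nx] := pselect (range p x).
    have /existsNP[l nl] : ~ forall l, C (p t) l q by move=> h; apply: noq; exists t.
    by exists l.
  by have /existsNP[l _] : ~ forall l, C (p Leaf) l q;
    [move=> h; apply: noq; exists Leaf|exists l => /nx].
have [|s [ps cov]] := small (range p) a; first by exists (p Leaf); exists Leaf.
have /choice[c cP] : forall k, exists t, p t = s k.
  by move=> k; have [t _ <-] := ps k; exists t.
(* The points s k selected by the covering hypothesis come from trees c k, which
   assemble into a tree whose point escapes the cover. *)
have pE : p (Node c (a \o s)) = out (\bigcup_k C (s k) (a (s k))).
  by congr (out _); apply: eq_bigcupr => k _; rewrite -/p cP.
apply: (outP (\bigcup_k C (s k) (a (s k)))); last first.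
  by rewrite -pE; apply: cov; exists (Node c (a \o s)).
move=> full; have [k _] : (\bigcup_k C (s k) (a (s k))) q by rewrite full.
exact: aP.
Qed.

(** * Neighborhoods indexed by the cardinal functions *)

Lemma card_sup_ge (I : Type) (F : I -> Type) i : [set: F i] #<= [set: card_sup F].
Proof. exact: (card_sup_is_least F).1. Qed.

Lemma card_le_natD (M : Type) : [set: M] #<= [set: nat + M].
Proof. by apply/card_leTP; exists inr => x y []. Qed.

Lemma option_natD_inj (M : Type) :
  exists o : option (nat + M) -> nat + M, injective o.
Proof.
exists (fun z => match z with
  | None => inl 0 | Some (inl i) => inl i.+1 | Some (inr m) => inr m end).
by move=> [[i|m]|] [[j|m']|] //= [->].
Qed.

(** The least base at x may be smaller than psiw_theta X; unused indices repeat a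
    member of the base. *)
Lemma psiw_theta_base (X : topologicalType) (x : X) :
  exists U : psiw_theta X -> set X,
    (forall l, open (U l) /\ U l x) /\
    \bigcap_l theta_closure (closure (U l)) `<=` urysohn_core x.
Proof.
have [[B [Bx <- BK]] _] := psiw_theta_at_is_least x.
have BL : B #<= [set: psiw_theta X].
  rewrite (card_le_eql BK).
  exact: card_le_trans (card_sup_ge _ x) (card_le_natD _).
have [[V0 BV0]|B0] := pselect (B !=set0); last first.
  (* The empty base is possible, when the core of x is the whole space. *)
  exists (fun=> setT); split; first by move=> _; split=> //; exact: openT.
  by move=> y _ V BV; case: B0; exists V.
have [h hI] := card_le_set_inj BV0 BL.
pose U l := if pselect (exists V, B V /\ h V = l) is left e
  then projT1 (cid e) else V0.
have BU l : B (U l).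
  by rewrite /U; case: pselect => // e; have [] := projT2 (cid e).
exists U; split; first by move=> l; exact/Bx/BU.
move=> y Uy V BV; suff <- : U (h V) = V by exact: Uy.
apply: hI => //; rewrite /U; case: pselect => [e|[]]; last by exists V.
by have [] := projT2 (cid e).
Qed.

(** The sets U y may coincide for distinct y in Y, so each chosen member of the
    cover is given one point of Y that it comes from. *)
Lemma htheta_aL_subcover (X : topologicalType) (Y : set X) (U : X -> set X) :
  Y !=set0 -> (forall x, open (U x) /\ U x x) ->
  exists s : htheta_aL X -> X, (forall k, Y (s k)) /\
    Y `<=` \bigcup_k theta_closure (closure (U (s k))).
Proof.
move=> [y0 Yy0] Uo; have [cov _] := theta_aL_is_least Y.
have [||V' [V'V V'K YV']] := cov (U @` Y).
- by move=> _ [x _ <-]; exact: (Uo x).1.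
- by move=> y Yy; exists (U y); [exists y|exact: (Uo y).2].
have [V0 V'V0 _] := YV' _ Yy0.
have [|h hI] := @card_le_set_inj _ (htheta_aL X) _ _ V'V0.
  apply: card_le_trans V'K _.
  exact: card_le_trans (card_sup_ge _ Y) (card_le_natD _).
have /choice[s sP] : forall k, exists x, Y x /\
    forall V, V' V -> h V = k -> U x = V.
  move=> k; have [[V [V'W hV]]|noV] := pselect (exists V, V' V /\ h V = k).
    have [x Yx xV] := V'V _ V'W; exists x; split=> // W V'W' hW.
    by rewrite xV; apply: hI => //; rewrite hV.
  by exists y0; split=> // V V'W hV; case: noV; exists V.
exists s; split=> [k|y /YV'[V V'W Vy]]; first exact: (sP k).1.
by exists (h V) => //; rewrite ((sP (h V)).2 V).
Qed.

Unset Implicit Arguments.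

Theorem theorem3p2 (X : topologicalType) (hX : accessible_space X) :
  [set: X] #<= [set: urysohn_width X * (htheta_aL X -> psiw_theta X)].
Proof.
apply/card_leTP; have [[x0]|noX] := pselect (inhabited X); last first.
  by exists (fun x => False_rect _ (noX (inhabits x))) => x; case: noX.
have /choice[U UP] := @psiw_theta_base X.
have [|p pP] := @tree_core X (htheta_aL X) _ x0
  (fun x l => theta_closure (closure (U x l))).
- move=> Y a Y0; apply: (@htheta_aL_subcover _ Y (fun x => U x (a x))) => // x.
  exact: (UP x).1.
have /choice[t tP] := pP.
have core q : urysohn_core (p (t q)) q.
  by apply: (UP (p (t q))).2 => l _; exact: tP.
have /choice[w wI] : forall x : X, exists w : X -> urysohn_width X,
    forall y z, urysohn_core x y -> urysohn_core x z -> w y = w z -> y = z.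
  move=> x; apply: (@card_le_set_inj _ _ _ x).
    by move=> V [_ Vx]; exact: sub_theta_closure.
  rewrite -(card_le_eql (card_setT _)).
  exact: (card_sup_ge (fun x : X => set_type (urysohn_core x))).
have [o oI] := option_natD_inj (card_sup (fun x : X => psiw_theta_at x)).
have inlI : injective (inl : nat -> htheta_aL X) by move=> i j [].
have [c cI] := tree_inj inlI oI.
(* A point q is determined by the tree t q, whose point has q in its core, and by
   the position of q in that core. *)
exists (fun q => (w (p (t q)) q, c (t q))) => q r [+ /cI qr].
by rewrite -qr; apply: wI; rewrite // qr.
Qed.
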